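(* Let $\mathbb{F}$ be a field, $k\ge 1$, and $f \in \mathbb{F}[x_1,\ldots,x_n]$. If $f$ is a read-$k$ projection of determinant, then $dc(f) \leq nk$.
   Context: Let $X=\{x_1,\ldots,x_n\}$. A matrix $M$ of size $m\times m$ is a read-$k$ matrix over $X\cup\mathbb{F}$ if every entry of $M$ lies in $X\cup\mathbb{F}$ and for every $x\in X$ there are at most $k$ pairs of indices $(i,j)$ with $M_{i,j}=x$. A polynomial $f\in\mathbb{F}[X]$ is a read-$k$ projection of determinant if $f=\det(M)$ for some read-$k$ matrix $M$ over $X\cup\mathbb{F}$ (of any size $m$). The determinantal complexity $dc(f)$ is the smallest $m$ such that $f=\det(M)$ for some $m\times m$ matrix $M$ whose entries are affine linear forms in $x_1,\ldots,x_n$ over $\mathbb{F}$. *)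

(* Defs.v *)
From HB Require Import structures.
From mathcomp Require Import all_boot all_order all_algebra.
From mathcomp Require Export mpoly.

Set Implicit Arguments.
Unset Strict Implicit.
Unset Printing Implicit Defensive.

Import GRing.Theory.
Local Open Scope ring_scope.

Definition read_k_matrix (F : fieldType) (n k m : nat)
    (M : 'M[{mpoly F[n]}]_m) : Prop :=
  (forall i j, (exists l : 'I_n, M i j = 'X_l) \/ (exists a : F, M i j = a%:MP))
  /\ (forall l : 'I_n, #|[set ij : 'I_m * 'I_m | M ij.1 ij.2 == 'X_l]| <= k)%N.

(* Matrix sizes are positive throughout; in particular the empty matrix, whose
   determinant is 1, is not allowed. *)
Definition read_k_projection_of_det (F : fieldType) (n k : nat)
    (f : {mpoly F[n]}) : Prop :=
  exists m (M : 'M[{mpoly F[n]}]_m),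
    [/\ (0 < m)%N, read_k_matrix k M & f = \det M].

(* Affine: a constant term is allowed. *)
Definition affine_form (F : fieldType) (n : nat) (p : {mpoly F[n]}) : Prop :=
  exists (c : F) (a : 'I_n -> F), p = c%:MP + \sum_(l < n) a l *: 'X_l.

Definition has_det_repr (F : fieldType) (n : nat) (f : {mpoly F[n]})
    (m : nat) : Prop :=
  (0 < m)%N /\ exists M : 'M[{mpoly F[n]}]_m,
    (forall i j, affine_form (M i j)) /\ f = \det M.

(* [is_dc f d] reads "dc(f) = d".  A relation is used instead of a function so
   that no default value is needed before a representation is known to exist. *)
Definition is_dc (F : fieldType) (n : nat) (f : {mpoly F[n]}) (d : nat) : Prop :=
  has_det_repr f d /\ (forall m, has_det_repr f m -> (d <= m)%N).

(* Main.v *)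
(* Write M = A + U W with A, U constant and W linear, W having one row for each
   entry of M holding a variable: there are r <= nk of them.  Then det M is the
   determinant of [[A, U], [-W, 1]], whose first m rows are constant.  Constant
   invertible column operations turn [A, U] into [L, 0], so det M is, up to a
   scalar, the determinant of the remaining lower right r x r block, whose
   entries are affine. *)
Require Import Defs.
From mathcomp Require Import all_boot all_order all_algebra.
From mathcomp Require Import mpoly.
From Stdlib Require Import Classical.

(** [Q] is an arbitrary [Prop], so the least witness comes from strong induction with excluded
    middle instead of a boolean search. *)
Lemma exists_least (Q : nat -> Prop) (m : nat) :
  Q m -> exists d, [/\ Q d, d <= m & forall j, Q j -> d <= j].
Proof.
elim/ltn_ind: m => m IHm Qm.
have [[j [ltjm Qj]]|noj] := classic (exists j, j < m /\ Q j).
  have [d [Qd ledj dmin]] := IHm j ltjm Qj.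
  by exists d; split=> //; apply: leq_trans ledj (ltnW ltjm).
exists m; split=> // j Qj; rewrite leqNgt; apply/negP=> ltjm.
by case: noj; exists j.
Qed.

Section DeterminantalComplexity.

Import GRing.Theory.
Local Open Scope ring_scope.

Variables (F : fieldType) (n : nat).
Implicit Types (p q : {mpoly F[n]}).

Lemma affine_formC (c : F) : affine_form (c%:MP : {mpoly F[n]}).
Proof.
by exists c, (fun=> 0); rewrite big1 ?addr0 // => l _; rewrite scale0r.
Qed.

Lemma affine_formX (l : 'I_n) : affine_form ('X_l : {mpoly F[n]}).
Proof.
exists 0, (fun i => (i == l)%:R); rewrite mpolyC0 add0r (bigD1 l) //= eqxx scale1r.
by rewrite big1 ?addr0 // => i /negPf ->; rewrite scale0r.
Qed.

Lemma affine_formD p q : affine_form p -> affine_form q -> affine_form (p + q).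
Proof.
move=> [c [a ->]] [d [b ->]]; exists (c + d), (fun l => a l + b l).
rewrite mpolyCD addrACA -big_split /=; congr (_ + _).
by apply: eq_bigr => l _; rewrite scalerDl.
Qed.

Lemma affine_formZ (c : F) p : affine_form p -> affine_form (c *: p).
Proof.
move=> [d [a ->]]; exists (c * d), (fun l => c * a l).
rewrite scalerDr scaler_sumr -mul_mpolyC mpolyCM; congr (_ + _).
by apply: eq_bigr => l _; rewrite scalerA.
Qed.

(** Each entry of the product is an [F]-linear combination of entries of one row of [W]; this is why
    constant column operations are harmless. *)
Lemma affine_mulmx_map m r s (W : 'M[{mpoly F[n]}]_(m, r)) (C : 'M[F]_(r, s)) :
    (forall i j, affine_form (W i j)) ->
  forall i j, affine_form ((W *m map_mx (mpolyC n (R := F)) C) i j).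
Proof.
move=> affW i j; rewrite mxE.
apply: (big_ind (@affine_form F n)) => [||l _].
- by rewrite -mpolyC0; apply: affine_formC.
- exact: affine_formD.
- by rewrite mxE mulrC mul_mpolyC; apply: affine_formZ.
Qed.

(** The scalar is absorbed by the first row, which exists because sizes are positive. *)
Lemma has_det_reprZ (c : F) p m : has_det_repr p m -> has_det_repr (c *: p) m.
Proof.
case: m => [|m] [] // _ [M [affM ->]]; split=> //.
pose d : 'rV[F]_m.+1 := \row_i (if i == 0 then c else 1).
exists (map_mx (mpolyC n (R := F)) (diag_mx d) *m M); split=> [i j|].
  rewrite map_diag_mx mul_diag_mx !mxE mul_mpolyC.
  exact: affine_formZ.
rewrite det_mulmx det_map_mx det_diag big_ord_recl big1 => [|i _].
  by rewrite mxE eqxx mulr1 mul_mpolyC.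
by rewrite mxE.
Qed.

(** Right multiplication by the unitriangular matrix [[1, 0], [W, 1]] clears the block [- W] and
    turns [A] into [A + U *m W]. *)
Lemma det_schur1 (R : comNzRingType) m r (A : 'M[R]_m) (U : 'M[R]_(m, r))
    (W : 'M[R]_(r, m)) :
  \det (A + U *m W) = \det (block_mx A U (- W) 1%:M).
Proof.
have := det_mulmx (block_mx A U (- W) 1%:M) (block_mx 1%:M 0 W 1%:M).
rewrite mulmx_block !mulmx1 !mulmx0 mul1mx addNr !add0r.
by rewrite det_ublock det_lblock !det1 !mulr1.
Qed.

Lemma has_det_repr_low_rank m r (A : 'M[F]_m) (U : 'M[F]_(m, r))
    (W : 'M[{mpoly F[n]}]_(r, m)) :
    (0 < r)%N -> (forall i j, affine_form (W i j)) ->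
  has_det_repr (\det (map_mx (mpolyC n (R := F)) A
                      + map_mx (mpolyC n (R := F)) U *m W)) r.
Proof.
move=> r_gt0 affW; rewrite det_schur1.
set f := \det _; pose B := row_mx A U; pose C := invmx (row_ebase B).
pose L : 'M[F]_m := col_ebase B *m pid_mx (\rank B).
have BC : B *m C = row_mx L 0.
  rewrite -{1}(mulmx_ebase B) mulmxK ?row_ebase_unit //.
  (* The ones of [pid_mx] lie on the diagonal, and a row index [i < m] never equals a column index
     [m + j]. *)
  have -> : pid_mx (\rank B) = row_mx (pid_mx (\rank B)) 0 :> 'M[F]_(m, m + r).
    rewrite -[LHS]hsubmxK; congr row_mx; apply/matrixP=> i j; rewrite !mxE //=.
    by rewrite (ltn_eqF (ltn_addr j (ltn_ord i))).
  by rewrite mul_mx_row mulmx0.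
pose K := row_mx (- W) 1%:M *m map_mx (mpolyC n (R := F)) C.
have affK i j : affine_form (K i j).
  apply: affine_mulmx_map => {}i {}j; rewrite mxE; case: split => l; rewrite mxE.
    by rewrite -scaleN1r; apply: affine_formZ.
  by rewrite -mpolyC_nat; apply: affine_formC.
have detC : \det C != 0 by rewrite -unitfE -unitmxE unitmx_inv row_ebase_unit.
(* Multiplying the block matrix by [C] gives top rows [L, 0] and bottom rows [K], a block lower
   triangular matrix. *)
have fC : \det C *: f = \det L *: \det (rsubmx K).
  rewrite -!mul_mpolyC -!det_map_mx mulrC -det_mulmx -/f.
  rewrite -(det_lblock _ (lsubmx K)); congr (\det _); rewrite block_mxEv mul_col_mx.
  rewrite -map_row_mx -map_mxM BC map_row_mx map_mx0 -/K.
  by rewrite -[in LHS](hsubmxK K) -block_mxEv.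
have -> : f = ((\det C)^-1 * \det L) *: \det (rsubmx K).
  by rewrite -scalerA -fC scalerA mulVf ?scale1r.
apply: has_det_reprZ; split=> //; exists (rsubmx K); split=> // i j.
by rewrite mxE.
Qed.

Lemma card_bigcup_leq (I T : finType) (B : I -> {set T}) (k : nat) :
  (forall i, #|B i| <= k)%N -> (#|\bigcup_i B i| <= #|I| * k)%N.
Proof.
move=> Bk; rewrite -sum_nat_const.
apply: (big_ind2 (fun (S : {set T}) s => #|S| <= s)%N) => [|S s S' s' leS leS'|//].
  by rewrite cards0.
exact: leq_trans (leq_card_setU _ _) (leq_add leS leS').
Qed.

Lemma read_k_det_repr k m (M : 'M[{mpoly F[n]}]_m) :
    (0 < n * k)%N -> read_k_matrix k M ->
  exists2 r, (r <= n * k)%N & has_det_repr (\det M) r.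
Proof.
move=> nk_gt0 [entM readM].
pose P := \bigcup_(l < n) [set ij : 'I_m * 'I_m | M ij.1 ij.2 == 'X_l].
have leP : (#|P| <= n * k)%N by have := card_bigcup_leq _ _ _ k readM; rewrite card_ord.
pose A : 'M[F]_m := \matrix_(i, j) if (i, j) \in P then 0 else (M i j)@_0%MM.
have entA i j : (i, j) \notin P -> M i j = (A i j)%:MP.
  move=> ijP; rewrite mxE (negPf ijP).
  have [[l Ml]|[a ->]] := entM i j; last by rewrite mcoeffC eqxx mulr1.
  by case/bigcupP: ijP; exists l => //; rewrite inE Ml.
have [P0|P_gt0] := posnP #|P|.
  (* Without variable entries the natural size would be 0, which is excluded; zero [U] and [W] of
     inner size 1 are used instead, and [1 <= n * k] by [nk_gt0]. *)
  exists 1%N => //.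
  have -> : M = map_mx (mpolyC n (R := F)) A
                + map_mx (mpolyC n (R := F)) (0 : 'M_(m, 1)) *m 0.
    rewrite mulmx0 addr0; apply/matrixP=> i j.
    by rewrite [RHS]mxE entA // (cards0_eq P0) inE.
  by apply: has_det_repr_low_rank => // i j; rewrite mxE -mpolyC0; apply: affine_formC.
exists #|P| => //.
pose pos (s : 'I_#|P|) : 'I_m * 'I_m := enum_val s.
(* Column [s] of [U] times row [s] of [W] is the matrix whose only possibly nonzero entry is that of
   [M] at [pos s]. *)
pose U : 'M[F]_(m, #|P|) := \matrix_(i, s) (i == (pos s).1)%:R.
pose W : 'M[{mpoly F[n]}]_(#|P|, m) :=
  \matrix_(s, j) if j == (pos s).2 then M (pos s).1 (pos s).2 else 0.
have -> : M = map_mx (mpolyC n (R := F)) A + map_mx (mpolyC n (R := F)) U *m W.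
  apply/matrixP=> i j; rewrite [RHS]mxE [X in X + _]mxE [X in _ + X]mxE.
  have UW s : map_mx (mpolyC n (R := F)) U i s * W s j
              = if (i, j) == pos s then M i j else 0.
    rewrite !mxE mpolyC_nat -pair_eqE /pair_eq /=.
    case: eqP => [->|_]; last by rewrite mul0r.
    by rewrite mul1r; case: eqP => [->|].
  rewrite (eq_bigr _ (fun s _ => UW s)).
  have [ijP|ijP] := boolP ((i, j) \in P); last first.
    rewrite big1 ?addr0 ?entA // => s _; case: eqP => // ijs.
    by rewrite ijs enum_valP in ijP.
  (* Exactly one index [s] enumerates [(i, j)], so a single summand survives. *)
  rewrite mxE ijP mpolyC0 add0r (bigD1 (enum_rank_in ijP (i, j))) //=.
  rewrite /pos enum_rankK_in // eqxx big1 ?addr0 // => s neqs.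
  by case: eqP => // ijs; rewrite -(enum_valK_in ijP s) -ijs eqxx in neqs.
apply: has_det_repr_low_rank => // s j; rewrite mxE; case: ifP => _.
  have [[l ->]|[a ->]] := entM (pos s).1 (pos s).2.
    exact: affine_formX.
  exact: affine_formC.
by rewrite -mpolyC0; apply: affine_formC.
Qed.

End DeterminantalComplexity.

Theorem theorem1 (F : fieldType) (n k : nat) (hn : 0 < n) (hk : 1 <= k)
    (f : {mpoly F[n]}) (hf : read_k_projection_of_det k f) :
  exists d : nat, is_dc f d /\ d <= n * k.
Proof.
have [m [M [_ readM ->]]] := hf.
have nk_gt0 : 0 < n * k by rewrite muln_gt0 hn.
have [r ler repr] := read_k_det_repr F n k m M nk_gt0 readM.
have [d [reprd ledr dmin]] := exists_least (has_det_repr (\det M)) r repr.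
by exists d; split; [split | apply: leq_trans ledr ler].
Qed.
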